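(* Let $(C_n(x;\beta|q))_{n\ge0}$ be the continuous $q$-ultraspherical polynomials, let $(\mathcal C_n(x;\beta|q))$ be their orthonormal version, with recurrence coefficients $$\lambda_n=\frac12\sqrt{\frac{(1-q^{n+1})(1-\beta^2q^n)}{(1-\beta q^n)(1-\beta q^{n+1})}},\quad n\ge0,$$ and let $(\alpha_n)_{n\ge0}$ be given by $\alpha_0=0$, $\alpha_{n+1}=\lambda_n^2/(1-\alpha_n)$. (i) Assume $0\le\beta\le q<1$. Then $(\lambda_n)$ is an increasing sequence with limit $1/2$, and therefore $$\inf\{\mathcal C_{n-1}^2(x;\beta|q)+\mathcal C_n^2(x;\beta|q)\mid x\in\mathbb R,\ n\ge1\}>0.$$ (ii) Assume $0\le q\le\beta<1$. Then $(\lambda_n)$ is a decreasing sequence with limit $1/2$, and the sequence $(\alpha_n)$ is increasing and concave with limit $1/2$. In particular, with $p_n(x)=C_n(x;\beta|q)/C_n(1;\beta|q)$ and $\Delta_n(x)=p_n^2(x)-p_{n-1}(x)p_{n+1}(x)$, $$\frac{\Delta_n(x)}{1-x^2}\ge c\,\Delta_n(0),\quad -1<x<1,\ n\ge1,$$ where $c=2\alpha_1(1-\alpha_2)/(1-\alpha_1)$.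
   Context: For real $q,\beta$ with $|q|,|\beta|<1$ the polynomials $C_n(x;\beta|q)$ are defined by $C_{-1}=0$, $C_0=1$ and $$xC_n(x;\beta|q)=\frac{1-q^{n+1}}{2(1-\beta q^n)}C_{n+1}(x;\beta|q)+\frac{1-\beta^2q^{n-1}}{2(1-\beta q^n)}C_{n-1}(x;\beta|q),\quad n\ge0,$$ (the last term being $0$ for $n=0$; $q^0=1$ also for $q=0$). They are orthogonal with respect to a continuous weight function on $]-1,1[$. The orthonormal polynomials $\mathcal C_n$ satisfy $\mathcal C_0=1$, $x\mathcal C_n=\lambda_n\mathcal C_{n+1}+\lambda_{n-1}\mathcal C_{n-1}$ ($\mathcal C_{-1}=0$). The polynomials $p_n(x)=C_n(x;\beta|q)/C_n(1;\beta|q)$ satisfy $xp_n=\gamma_np_{n+1}+\alpha_np_{n-1}$ with $\gamma_n=1-\alpha_n$ and $(\alpha_n)$ as in the claim. ''Increasing'' and ''decreasing'' are meant in the weak sense; concave means that $\alpha_{n+1}-\alpha_n$ is decreasing in $n\ge 0$. *)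

(* Defs.v *)
From HB Require Import structures.
From mathcomp Require Import all_boot all_order all_algebra.
From mathcomp Require Import all_classical all_reals all_analysis.
From mathcomp Require Import ring lra.
Import numFieldNormedType.Exports.
Import Order.TTheory GRing.Theory Num.Theory.

Set Implicit Arguments.
Unset Strict Implicit.
Unset Printing Implicit Defensive.

Local Open Scope classical_set_scope.
Local Open Scope ring_scope.

Section ContinuousQUltraspherical.
Variables (R : realType) (q beta : R).

Definition cqu_up (n : nat) : R :=
  (1 - q ^+ n.+1) / (2 * (1 - beta * q ^+ n)).

(* Only meaningful for n >= 1. *)
Definition cqu_down (n : nat) : R :=
  (1 - beta ^+ 2 * q ^+ n.-1) / (2 * (1 - beta * q ^+ n)).

(* C_n(x; beta | q): the recurrence 'X C_n = up_n C_{n+1} + down_n C_{n-1},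
   solved for C_{n+1}; see cqu_rec0 and cqu_recS. *)
Fixpoint cqu (n : nat) : {poly R} :=
  match n with
  | 0 => 1
  | m.+1 => (cqu_up m)^-1 *: ('X * cqu m -
      match m with 0 => 0 | k.+1 => cqu_down m *: cqu k end)
  end.

Definition cqu_lambda (n : nat) : R :=
  2^-1 * Num.sqrt (((1 - q ^+ n.+1) * (1 - beta ^+ 2 * q ^+ n)) /
                   ((1 - beta * q ^+ n) * (1 - beta * q ^+ n.+1))).

(* The orthonormal version of cqu, generated by its three-term recurrence;
   see cquo_cqu and cquo_orthonormal. *)
Fixpoint cquo (n : nat) : {poly R} :=
  match n with
  | 0 => 1
  | m.+1 => (cqu_lambda m)^-1 *: ('X * cquo m -
      match m with 0 => 0 | k.+1 => cqu_lambda k *: cquo k end)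
  end.

Fixpoint cqu_alpha (n : nat) : R :=
  if n is m.+1 then cqu_lambda m ^+ 2 / (1 - cqu_alpha m) else 0.

Definition cqu_p (n : nat) (x : R) : R := (cqu n).[x] / (cqu n).[1].

(* Only meaningful for n >= 1. *)
Definition cqu_Delta (n : nat) (x : R) : R :=
  cqu_p n x ^+ 2 - cqu_p n.-1 x * cqu_p n.+1 x.

Section Recurrences.
Hypotheses (hq : `|q| < 1) (hbeta : `|beta| < 1).

Let qX_le1 n : `|q ^+ n| <= 1.
Proof. by rewrite normrX exprn_ile1 // ltW. Qed.

Let subqS_gt0 n : 0 < 1 - q ^+ n.+1.
Proof.
by rewrite subr_gt0 (le_lt_trans (ler_norm _)) // normrX exprn_ilt1.
Qed.

Let subbq_gt0 n : 0 < 1 - beta * q ^+ n.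
Proof.
rewrite subr_gt0 (le_lt_trans (ler_norm _)) // normrM.
by rewrite (le_lt_trans _ hbeta) // ler_piMr.
Qed.

Let subb2q_gt0 n : 0 < 1 - beta ^+ 2 * q ^+ n.
Proof.
rewrite subr_gt0 (le_lt_trans (ler_norm _)) // normrM.
rewrite (@le_lt_trans _ _ `|beta ^+ 2|) // ?ler_piMr //.
by rewrite normrX exprn_ilt1.
Qed.

Let up_gt0 n : 0 < cqu_up n.
Proof. by rewrite /cqu_up divr_gt0 ?mulr_gt0. Qed.

Let lambda_gt0 n : 0 < cqu_lambda n.
Proof. by rewrite /cqu_lambda mulr_gt0 ?invr_gt0 // sqrtr_gt0 divr_gt0 ?mulr_gt0. Qed.

Let lambda_sqr n : cqu_lambda n ^+ 2 = cqu_up n * cqu_down n.+1.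
Proof.
rewrite /cqu_lambda exprMn sqr_sqrtr; last by rewrite ltW // divr_gt0 ?mulr_gt0.
rewrite /cqu_up /cqu_down /=; field.
by rewrite !gt_eqF.
Qed.

Let cquSS n :
  cqu n.+2 = (cqu_up n.+1)^-1 *: ('X * cqu n.+1 - cqu_down n.+1 *: cqu n).
Proof. by []. Qed.

Let cquoSS n :
  cquo n.+2 = (cqu_lambda n.+1)^-1 *: ('X * cquo n.+1 - cqu_lambda n *: cquo n).
Proof. by []. Qed.

Lemma cqu_rec0 : 'X * cqu 0 = cqu_up 0 *: cqu 1.
Proof. by rewrite /= subr0 scalerA divff ?scale1r // gt_eqF. Qed.

Lemma cqu_recS n :
  'X * cqu n.+1 = cqu_up n.+1 *: cqu n.+2 + cqu_down n.+1 *: cqu n.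
Proof.
rewrite cquSS.
by rewrite scalerA divff ?gt_eqF // scale1r subrK.
Qed.

Lemma cquo_rec0 : 'X * cquo 0 = cqu_lambda 0 *: cquo 1.
Proof. by rewrite /= subr0 scalerA divff ?scale1r // gt_eqF. Qed.

Lemma cquo_recS n :
  'X * cquo n.+1 = cqu_lambda n.+1 *: cquo n.+2 + cqu_lambda n *: cquo n.
Proof.
rewrite cquoSS.
by rewrite scalerA divff ?gt_eqF // scale1r subrK.
Qed.

Lemma cquo_cqu n : exists2 k : R, 0 < k & cquo n = k *: cqu n.
Proof.
pose k n : R := \prod_(i < n) (cqu_up i / cqu_lambda i).
have kS m : k m.+1 = k m * (cqu_up m / cqu_lambda m) by rewrite /k big_ord_recr.
have E : forall m, cquo m = k m *: cqu m /\ cquo m.+1 = k m.+1 *: cqu m.+1.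
  elim=> [|m [E0 E1]].
    have k0 : k 0%N = 1 by rewrite /k big_ord0.
    rewrite kS k0 scale1r mul1r; split=> //.
    by rewrite /= scalerA mulrAC divff ?mul1r // gt_eqF.
  split=> //.
  rewrite cquoSS cquSS.
  rewrite E0 E1 -scalerAr !scalerBr !scalerA; congr (_ *: _ - _ *: _).
    by rewrite (kS m.+1); field; rewrite !gt_eqF.
  have l0 : cqu_lambda m != 0 by rewrite gt_eqF.
  have -> : cqu_lambda m = cqu_up m * cqu_down m.+1 / cqu_lambda m.
    by rewrite -lambda_sqr expr2 mulfK.
  by rewrite !kS; field; rewrite !gt_eqF.
exists (k n); last by case: (E n).
by apply: prodr_gt0 => i _; rewrite divr_gt0.
Qed.

(* L is integration against any normalised orthogonality measure. *)
Lemma cquo_orthonormal (L : {linear {poly R} -> R^o}) :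
  L 1 = 1 -> (forall m n : nat, m != n -> L (cqu m * cqu n) = 0) ->
  forall m n : nat, L (cquo m * cquo n) = (m == n)%:R.
Proof.
move=> L1 Lo.
have LZ a p : L (a *: p) = a * L p by rewrite linearZ.
have LD a b p r s : L ((a *: p + b *: r) * s) = a * L (p * s) + b * L (r * s).
  by rewrite mulrDl linearD -!scalerAl !LZ.
have O m n : m != n -> L (cquo m * cquo n) = 0.
  have [k _ ->] := cquo_cqu m; have [l _ ->] := cquo_cqu n.
  by move=> mn; rewrite -scalerAl -scalerAr !LZ Lo // !mulr0.
have O2 m : L (cquo m * cquo m.+2) = 0 by apply: O; rewrite ltn_eqF.
have X m : L ('X * cquo m * cquo m.+1) = cqu_lambda m * L (cquo m.+1 * cquo m.+1).
  case: m => [|m]; first by rewrite cquo_rec0 -scalerAl LZ.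
  by rewrite cquo_recS LD O2 mulr0 addr0.
have Y m : L (cquo m * ('X * cquo m.+1)) = cqu_lambda m * L (cquo m * cquo m).
  by rewrite mulrC cquo_recS LD (mulrC (cquo m.+2)) O2 mulr0 add0r.
have N m : L (cquo m * cquo m) = 1.
  elim: m => [|m IH]; first by rewrite mulr1.
  have l0 : cqu_lambda m != 0 by rewrite gt_eqF.
  have e : 'X * cquo m * cquo m.+1 = cquo m * ('X * cquo m.+1).
    by rewrite [RHS]mulrCA mulrA.
  by apply: (mulfI l0); rewrite -X e Y IH.
move=> m n; case: eqVneq => [->|]; [exact: N|exact: O].
Qed.

End Recurrences.
End ContinuousQUltraspherical.

(* Main.v *)
(* Everything rests on
     4 lambda_n^2 = 1 - (q - beta) (1 - beta) s_n,
     s_n = q^n / ((1 - beta q^n) (1 - beta q^(n+1))),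
   where s_n decreases to 0.

   (i) For orthonormal y_n with increasing l_n <= 1/2 the quantity
     l_n^2 (y_n^2 + y_(n+1)^2) - x l_n y_n y_(n+1)
   increases with n and equals l_0^2 at n = 0; for |x| <= 1 it is at most
   (y_n^2 + y_(n+1)^2) / 2, while for |x| >= 1 the |y_n| increase.

   (ii) With g_n = 1 - alpha_n, D_n = Delta_n / (1 - x^2) and
   Q_n = (p_n - p_(n+2)) / (1 - x^2), one has
     g_(n+1) D_(n+1) = alpha_n D_n + (alpha_(n+1) - alpha_n)
                         (g_(n+1)^2 Q_n^2 - alpha_n^2 Q_(n-1)^2).
   By concavity of alpha, the lower bound
     (alpha_(n+1) - alpha_n) alpha_n g_n Q_(n-1)^2
       + (alpha_1 g_2 / g_1) prod_(1 <= k < n) (alpha_k / g_k)  <=  g_n D_n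
   propagates, whereas Delta_n(0) <= prod_(1 <= k <= n) (alpha_k / g_k). *)

Require Import Defs.
From mathcomp Require Import all_boot all_order all_algebra.
From mathcomp Require Import all_classical all_reals all_analysis.
From mathcomp Require Import ring lra.
Import numFieldNormedType.Exports.
Import Order.TTheory GRing.Theory Num.Theory.

Local Open Scope classical_set_scope.
Local Open Scope ring_scope.

(** * Sums of consecutive squares of orthonormal polynomials *)

(** Here [y] lists the values of the orthonormal polynomials at a fixed [x]; the bound depends on
    neither [x] nor [n], so it passes to the infimum. *)
Lemma orthonormal_sqr_sum_ge (R : realFieldType) (l y : nat -> R) (x : R) :
  0 < l 0%N -> (forall n, l n <= l n.+1) -> (forall n, l n <= 2^-1) ->
  y 0%N = 1 -> l 0%N * y 1%N = x ->
  (forall n, l n.+1 * y n.+2 = x * y n.+1 - l n * y n) ->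
  forall n, 2 * l 0%N ^+ 2 <= y n ^+ 2 + y n.+1 ^+ 2.
Proof.
move=> l0 lS lh y0 y1 yS n.
have lp m : l 0%N <= l m by elim: m => // m /le_trans; apply.
have l0h := lh 0%N.
case: (lerP `|x| 1) => [x1|/ltW x1]; last first.
  (* As the [l m] are at most 1/2, |x| |y_(m+1)| <= (|y_(m+2)| + |y_m|) / 2, and |y_m| <= |y_(m+1)|
     then forces |y_(m+1)| <= |y_(m+2)|. *)
  have ynd m : 1 <= `|y m| /\ `|y m| <= `|y m.+1|.
    elim: m => [|m [IH1 IH2]].
      rewrite y0 normr1; split=> //.
      have : `|l 0%N * y 1%N| >= 1 by rewrite y1.
      rewrite normrM (gtr0_norm l0) => h.
      have : l 0%N * `|y 1%N| <= 2^-1 * `|y 1%N| by rewrite ler_wpM2r.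
      by lra.
    have lm := lp m; have lmh := lh m; have lSm := lp m.+1; have lSh := lh m.+1.
    have h : `|x| * `|y m.+1| <= l m.+1 * `|y m.+2| + l m * `|y m|.
      have -> : `|x| * `|y m.+1| = `|l m.+1 * y m.+2 + l m * y m|.
        by rewrite yS subrK normrM.
      by rewrite (le_trans (ler_normD _ _)) // !normrM !(@ger0_norm _ (l _)) //; lra.
    split; first lra.
    have : `|y m.+1| <= `|x| * `|y m.+1| by rewrite ler_peMl.
    have : l m * `|y m| <= 2^-1 * `|y m.+1| by apply: ler_pM => //; lra.
    have : l m.+1 * `|y m.+2| <= 2^-1 * `|y m.+2| by apply: ler_pM => //; lra.
    by lra.
  have [h _] := ynd n.
  have : 1 <= `|y n| ^+ 2 by rewrite exprn_ege1.
  rewrite -normrX ger0_norm ?sqr_ge0 // => hh.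
  have := sqr_ge0 (y n.+1); nra.
have K m : l 0%N ^+ 2 <= l m ^+ 2 * (y m ^+ 2 + y m.+1 ^+ 2)
                         - x * (l m * (y m * y m.+1)).
  elim: m => [|m IH].
    by rewrite y0 -y1 le_eqVlt; apply/orP; left; apply/eqP; ring.
  have -> : l m.+1 ^+ 2 * (y m.+1 ^+ 2 + y m.+2 ^+ 2)
          - x * (l m.+1 * (y m.+1 * y m.+2))
        = l m ^+ 2 * (y m ^+ 2 + y m.+1 ^+ 2) - x * (l m * (y m * y m.+1))
          + (l m.+1 ^+ 2 - l m ^+ 2) * y m.+1 ^+ 2.
    have -> : l m.+1 ^+ 2 * (y m.+1 ^+ 2 + y m.+2 ^+ 2) =
       l m.+1 ^+ 2 * y m.+1 ^+ 2 + (l m.+1 * y m.+2) ^+ 2 by ring.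
    have -> : l m.+1 * (y m.+1 * y m.+2) = y m.+1 * (l m.+1 * y m.+2) by ring.
    by rewrite yS; ring.
  apply: (le_trans IH); rewrite lerDl mulr_ge0 ?sqr_ge0 // subr_ge0.
  by have := lS m; have := lp m => *; rewrite lerXn2r // nnegrE; lra.
apply: (@le_trans _ _ (2 * (l n ^+ 2 * (y n ^+ 2 + y n.+1 ^+ 2)
                         - x * (l n * (y n * y n.+1))))).
  by have := K n; lra.
have lnh := lh n; have ln := lp n.
set S := y n ^+ 2 + y n.+1 ^+ 2.
have S0 : 0 <= S by rewrite addr_ge0 ?sqr_ge0.
(* Each of the two terms is at most [S / 4] in absolute value, by l_n <= 1/2, |x| <= 1 and |y_n
   y_(n+1)| <= S / 2. *)
have h1 : l n ^+ 2 * S <= 4^-1 * S by apply: ler_wpM2r => //; nra.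
have h2 : `|x * (l n * (y n * y n.+1))| <= 1 * (2^-1 * (2^-1 * S)).
  rewrite normrM ler_pM // normrM ler_pM //; first by rewrite ger0_norm //; lra.
  rewrite ler_norml /S.
  by have := sqr_ge0 (y n + y n.+1); have := sqr_ge0 (y n - y n.+1) => *; apply/andP; split; nra.
by move: h2; rewrite ler_norml => /andP[]; lra.
Qed.

(** * Turán determinants for increasing concave coefficients *)

(** The common yardstick of the two estimates below: it dominates the Turán determinant at 0, and a
    multiple of it minorises the one at [x] divided by 1 - x^2. *)
Definition ratio_prod {R : realFieldType} (a : nat -> R) (n : nat) : R :=
  \prod_(i < n) (a i.+1 / (1 - a i.+1)).

Section TuranBound.
Variables (R : realFieldType) (a p : nat -> R) (x : R).
Hypotheses (a0 : a 0%N = 0) (a1 : 0 < a 1%N) (a_half : forall n, a n <= 2^-1).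
Hypotheses (a_nd : forall n, a n <= a n.+1).
Hypotheses (a_concave : forall n, a n.+2 - a n.+1 <= a n.+1 - a n).
Hypotheses (p0 : p 0%N = 1) (p1 : p 1%N = x).
Hypothesis pS : forall n, x * p n.+1 = (1 - a n.+1) * p n.+2 + a n.+1 * p n.

Let aS_gt0 n : 0 < a n.+1.
Proof. by elim: n => // n IH; rewrite (lt_le_trans IH). Qed.

Let g_gt0 n : 0 < 1 - a n.
Proof. by have := a_half n; lra. Qed.

Let ratio_prodS n : ratio_prod a n.+1 = ratio_prod a n * (a n.+1 / (1 - a n.+1)).
Proof. by rewrite /ratio_prod big_ord_recr. Qed.

Let ratio_prod_ge0 n : 0 <= ratio_prod a n.
Proof. by apply: prodr_ge0 => i _; rewrite divr_ge0 // ltW. Qed.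

Let pSS n : p n.+2 = (x * p n.+1 - a n.+1 * p n) / (1 - a n.+1).
Proof. by rewrite pS addrK mulrC mulKf // gt_eqF. Qed.

(** At [x = 0] the recurrence reads p_(k+1) = - (a_k / (1 - a_k)) p_(k-1). With consecutive ratios s
    <= t, the next determinant falls short of t times the current one by s (t - s) p_n^2 >= 0. *)
Lemma turan0_le n : x = 0 -> p n.+1 ^+ 2 - p n * p n.+2 <= ratio_prod a n.+1.
Proof.
move=> x0; elim: n => [|n IH].
  rewrite ratio_prodS /ratio_prod big_ord0 pSS p0 p1 x0 le_eqVlt.
  by apply/orP; left; apply/eqP; ring.
have rS : a n.+1 / (1 - a n.+1) <= a n.+2 / (1 - a n.+2).
  by rewrite ler_pdivrMr // mulrAC ler_pdivlMr //; have := a_nd n.+1; nra.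
have r1 : 0 <= a n.+1 / (1 - a n.+1) by rewrite divr_ge0 // ltW.
apply: (@le_trans _ _ ((p n.+1 ^+ 2 - p n * p n.+2) * (a n.+2 / (1 - a n.+2)))).
  have -> : p n.+3 = - (a n.+2 / (1 - a n.+2)) * p n.+1 by rewrite pSS x0; ring.
  have -> : p n.+2 = - (a n.+1 / (1 - a n.+1)) * p n by rewrite pSS x0; ring.
  set s := a n.+1 / _ in rS r1 *; set t := a n.+2 / _ in rS *.
  rewrite -subr_ge0.
  have -> : (p n.+1 ^+ 2 - p n * (- s * p n)) * t -
     ((- s * p n) ^+ 2 - p n.+1 * (- t * p n.+1)) = s * (t - s) * p n ^+ 2 by ring.
  by rewrite mulr_ge0 ?sqr_ge0 // mulr_ge0 ?subr_ge0.
by rewrite [leRHS]ratio_prodS ler_wpM2r // (le_trans r1) //.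
Qed.

Hypotheses (x_gt : -1 < x) (x_lt : x < 1).

Let w_gt0 : 0 < 1 - x ^+ 2.
Proof. by rewrite subr_gt0 -real_normK ?num_real // expr_lt1 // ltr_norml x_gt. Qed.

(** [D n] is centred at index n + 1, so it is D_(n+1) in the notation above, while [Q n] is Q_n. *)
Let D n := (p n.+1 ^+ 2 - p n * p n.+2) / (1 - x ^+ 2).
Let Q n := (p n - p n.+2) / (1 - x ^+ 2).

Let D_rec n : (1 - a n.+2) * D n.+1 = a n.+1 * D n
  + (a n.+2 - a n.+1) * (((1 - a n.+2) * Q n.+1) ^+ 2 - (a n.+1 * Q n) ^+ 2).
Proof.
rewrite /D /Q (pSS n.+1) (pSS n); field.
by rewrite !gt_eqF.
Qed.

(** The constant in front of [ratio_prod] is the one that makes the case n = 0 an equality: there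
    Q_0 = 1 / (1 - a_1) and (1 - a_1) [D 0] = a_1. *)
Lemma turan_ge_aux n :
  (a n.+2 - a n.+1) * (a n.+1 * (1 - a n.+1) * Q n ^+ 2)
  + a 1%N * (1 - a 2%N) / (1 - a 1%N) * ratio_prod a n <= (1 - a n.+1) * D n.
Proof.
elim: n => [|n IH].
  rewrite /Q /D /ratio_prod big_ord0 pSS p0 p1 le_eqVlt; apply/orP; left.
  by apply/eqP; field; rewrite !gt_eqF.
rewrite D_rec ratio_prodS.
set B := _ * _ / _ in IH *; set r := ratio_prod a n in IH *.
have an := aS_gt0 n; have an1 := aS_gt0 n.+1.
have gn := g_gt0 n.+1; have gn1 := g_gt0 n.+2.
(* The induction hypothesis times a_(n+1) / (1 - a_(n+1)); its first term cancels the negative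
   square in [D_rec]. *)
have {IH}h : (a n.+2 - a n.+1) * (a n.+1 * Q n) ^+ 2
     + B * (r * (a n.+1 / (1 - a n.+1))) <= a n.+1 * D n.
  have : 0 <= a n.+1 / (1 - a n.+1) by rewrite divr_ge0 // ltW.
  move/(ler_wpM2r)/(_ _ _ IH); congr (_ <= _); field; exact: lt0r_neq0.
have an12 := a_nd n.+1; have an23 := a_nd n.+2.
have hn := a_half n.+2; have cn := a_concave n.+1.
(* The surviving positive square pays for the next Q-term: the increments of [a] decrease, and
   a_(n+2) <= 1 - a_(n+2). *)
have e : (a n.+3 - a n.+2) * (a n.+2 * (1 - a n.+2))
       <= (a n.+2 - a n.+1) * ((1 - a n.+2) * (1 - a n.+2)).
  by apply: ler_pM; rewrite ?subr_ge0 ?mulr_ge0 ?(ltW an1) ?(ltW gn1) // ler_wpM2r ?(ltW gn1) //; lra.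
have := ler_wpM2r (sqr_ge0 (Q n.+1)) e; rewrite !exprMn in h *; lra.
Qed.

(** The nonnegative Q-term is dropped. Passing from [ratio_prod a n] to [ratio_prod a n.+1] leaves a
    factor a_(n+1) <= 1/2, which is what allows the 2 in the constant. *)
Lemma turan_ge n :
  2 * a 1%N * (1 - a 2%N) / (1 - a 1%N) * ratio_prod a n.+1 <= D n.
Proof.
have := turan_ge_aux n; rewrite ratio_prodS.
have an := aS_gt0 n; have gn := g_gt0 n.+1; have hn := a_half n.+1.
have d0 : 0 <= a n.+2 - a n.+1 by rewrite subr_ge0.
have : 0 <= (a n.+2 - a n.+1) * (a n.+1 * (1 - a n.+1) * Q n ^+ 2).
  apply: mulr_ge0 => //; apply: mulr_ge0; last exact: sqr_ge0.
  by rewrite mulr_ge0 // ltW.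
have : 0 <= a 1%N * (1 - a 2%N) / (1 - a 1%N) * ratio_prod a n.
  by rewrite mulr_ge0 ?divr_ge0 ?mulr_ge0 // ltW.
have -> : 2 * a 1%N * (1 - a 2%N) / (1 - a 1%N) *
    (ratio_prod a n * (a n.+1 / (1 - a n.+1))) =
   (2 * a n.+1) * (a 1%N * (1 - a 2%N) / (1 - a 1%N) * ratio_prod a n)
     / (1 - a n.+1).
  by field; rewrite !gt_eqF.
set B := _ * ratio_prod a n => B0 S0 h.
rewrite ler_pdivrMr // mulrC [leRHS]mulrC.
by apply: (@le_trans _ _ B); [rewrite ler_piMr //; lra | lra].
Qed.

End TuranBound.

(** * The recursion a_(n+1) = L_n / (1 - a_n) *)

Section ChainSequence.
Variables (R : realType) (a L : nat -> R).
Hypotheses (a0 : a 0%N = 0) (aS : forall n, a n.+1 = L n / (1 - a n)).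
Hypotheses (a_half : forall n, a n <= 2^-1).
Hypotheses (L_ge : forall n, 4^-1 <= L n) (L_ni : forall n, L n.+1 <= L n).

Let g_gt0 n : 0 < 1 - a n.
Proof. by have := a_half n; lra. Qed.

Let aSM n : a n.+1 * (1 - a n) = L n.
Proof. by rewrite aS divfK // gt_eqF. Qed.

(** Because a (1 - a) <= 1/4 <= L_n for every real a. *)
Lemma chain_le n : a n <= a n.+1.
Proof.
rewrite aS ler_pdivlMr //; apply: le_trans (L_ge n).
by have := sqr_ge0 (a n - 2^-1); nra.
Qed.

(** L_(n+1) <= L_n = a_(n+1) (1 - a_n), and the slack left is (a_(n+1) - a_n) (1 - 2 a_(n+1)) >=
    0. *)
Lemma chain_concave n : a n.+2 - a n.+1 <= a n.+1 - a n.
Proof.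
rewrite lerBlDr aS ler_pdivrMr //; apply: (le_trans (L_ni n)).
rewrite -aSM -subr_ge0.
have -> : (a n.+1 - a n + a n.+1) * (1 - a n.+1) - a n.+1 * (1 - a n)
  = (a n.+1 - a n) * (1 - 2 * a n.+1) by ring.
by rewrite mulr_ge0 ?subr_ge0 ?chain_le //; have := a_half n.+1; lra.
Qed.

(** The bounded monotone sequence has a limit l with l (1 - l) = 1/4, whose only root is the double
    root 1/2. *)
Lemma chain_cvg : L n @[n --> \oo] --> (4^-1 : R) -> a n @[n --> \oo] --> (2^-1 : R).
Proof.
move=> Lcvg.
have al_nd : nondecreasing_seq a by apply/nondecreasing_seqP => n; exact: chain_le.
have acvg : cvgn a.
  by apply: nondecreasing_is_cvgn => //; exists 2^-1 => _ [n _ <-].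
have aScvg : a n.+1 @[n --> \oo] --> limn a.
  by rewrite (cvg_shiftS a).
have : a n.+1 * (1 - a n) @[n --> \oo] --> limn a * (1 - limn a).
  by apply: cvgM => //; apply: cvgB => //; exact: cvg_cst.
under eq_fun do rewrite aSM.
move=> /(cvg_unique _ Lcvg) => /(_ (@Rhausdorff R)) e.
have <- // : limn a = 2^-1.
apply/eqP; rewrite -subr_eq0 -sqrf_eq0; apply/eqP.
have -> : (limn a - 2^-1) ^+ 2 = 4^-1 - limn a * (1 - limn a) by field.
by apply/eqP; rewrite subr_eq0; apply/eqP.
Qed.

End ChainSequence.

(** * The coefficients lambda and alpha *)

Section QUltraspherical.
Variables (R : realType) (q beta : R).
Hypotheses (q_ge0 : 0 <= q) (q_lt1 : q < 1).
Hypotheses (beta_ge0 : 0 <= beta) (beta_lt1 : beta < 1).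

Let q_norm : `|q| < 1. Proof. by rewrite ger0_norm. Qed.
Let beta_norm : `|beta| < 1. Proof. by rewrite ger0_norm. Qed.

Let qX_ge0 n : 0 <= q ^+ n. Proof. exact: exprn_ge0. Qed.
Let qX_le1 n : q ^+ n <= 1. Proof. by rewrite exprn_ile1 // ltW. Qed.
Let qXS n : q ^+ n.+1 = q * q ^+ n. Proof. exact: exprS. Qed.
Let bq_gt0 n : 0 < 1 - beta * q ^+ n.
Proof. by rewrite subr_gt0 (le_lt_trans _ beta_lt1) // ler_piMr. Qed.
Let qS_gt0 n : 0 < 1 - q ^+ n.+1.
Proof. by rewrite subr_gt0 exprn_ilt1. Qed.
Let b2q_gt0 n : 0 < 1 - beta ^+ 2 * q ^+ n.
Proof.
have b1 : beta ^+ 2 < 1 by rewrite exprn_ilt1.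
by rewrite subr_gt0 (le_lt_trans _ b1) // ler_piMr ?sqr_ge0.
Qed.

Let lam := cqu_lambda q beta.
Let al := cqu_alpha q beta.
Let up := cqu_up q beta.
Let down := cqu_down q beta.

Let radicand (n : nat) : R := (1 - q ^+ n.+1) * (1 - beta ^+ 2 * q ^+ n) /
  ((1 - beta * q ^+ n) * (1 - beta * q ^+ n.+1)).

Let radicand_gt0 n : 0 < radicand n.
Proof. by rewrite divr_gt0 ?mulr_gt0. Qed.

Lemma cqu_lambda_gt0 n : 0 < lam n.
Proof.
by rewrite /lam /cqu_lambda mulr_gt0 ?invr_gt0 // sqrtr_gt0 radicand_gt0.
Qed.

Let lam_sqr n : lam n ^+ 2 = 4^-1 * radicand n.
Proof.
rewrite /lam /cqu_lambda -/(radicand n) exprMn (sqr_sqrtr (ltW (radicand_gt0 n))).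
by field.
Qed.

Let lam_up_down n : lam n ^+ 2 = up n * down n.+1.
Proof.
rewrite lam_sqr /up /down /radicand /cqu_up /cqu_down /=; field.
by rewrite !gt_eqF.
Qed.

Let s n := q ^+ n / ((1 - beta * q ^+ n) * (1 - beta * q ^+ n.+1)).

Let radicandE n : radicand n = 1 - (q - beta) * (1 - beta) * s n.
Proof.
rewrite /radicand /s; have := bq_gt0 n.+1; have := bq_gt0 n; rewrite qXS => *.
by field; rewrite !gt_eqF.
Qed.

Let s_ge0 n : 0 <= s n.
Proof. by rewrite divr_ge0 ?mulr_ge0 // ltW. Qed.

Let s_ni n : s n.+1 <= s n.
Proof.
have qn : q ^+ n.+1 <= q ^+ n by rewrite qXS ler_piMl // ltW.
have qn1 : q ^+ n.+2 <= q ^+ n.+1 by rewrite qXS ler_piMl // ltW.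
have b1 : 1 - beta * q ^+ n <= 1 - beta * q ^+ n.+1 by rewrite lerD2l lerN2 ler_wpM2l.
have b2 : 1 - beta * q ^+ n.+1 <= 1 - beta * q ^+ n.+2 by rewrite lerD2l lerN2 ler_wpM2l.
apply: ler_pM => //; first by rewrite invr_ge0 mulr_ge0 // ltW.
by rewrite lef_pV2 ?posrE ?mulr_gt0 // ler_pM // ltW.
Qed.

Let lam_le m n : (radicand m <= radicand n) -> lam m <= lam n.
Proof. by move=> h; rewrite /lam /cqu_lambda ler_pM2l ?invr_gt0 // ler_wsqrtr. Qed.

Let lam_le_half n : radicand n <= 1 -> lam n <= 2^-1.
Proof.
move=> h; rewrite /lam /cqu_lambda -/(radicand n) ler_piMr ?invr_ge0 //.
by rewrite -sqrtr1 ler_wsqrtr.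
Qed.

Lemma cqu_lambda_cvg : lam n @[n --> \oo] --> (2^-1 : R).
Proof.
have qc : q ^+ n @[n --> \oo] --> (0 : R) by exact: cvg_expr.
have qSc : q ^+ n.+1 @[n --> \oo] --> (0 : R).
  by rewrite (cvg_shiftS (GRing.exp q)).
have oneB c u : u n @[n --> \oo] --> (0 : R) ->
    1 - c * u n @[n --> \oo] --> (1 : R).
  move=> uc; rewrite -[X in _ --> X]subr0 -(mulr0 c).
  by apply: cvgB; [exact: cvg_cst | apply: cvgM => //; exact: cvg_cst].
have rc : radicand n @[n --> \oo] --> (1 : R).
  rewrite -[X in _ --> X](_ : (1 * 1) / (1 * 1) = 1 :> R); last by rewrite !mul1r invr1.
  apply: cvgM.
    apply: cvgM; last exact: oneB.
    by under eq_fun do rewrite -[q ^+ _]mul1r; exact: oneB.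
  by apply: cvgV; [rewrite mul1r oner_eq0 | apply: cvgM; exact: oneB].
rewrite -[X in _ --> X]mulr1 -{2}sqrtr1.
apply: cvgM; first exact: cvg_cst.
by apply: continuous_cvg => //; exact: sqrt_continuous.
Qed.

Lemma cqu_lambda_nd : beta <= q -> nondecreasing_seq lam.
Proof.
move=> bq; apply/nondecreasing_seqP => n; apply: lam_le.
rewrite !radicandE lerD2l lerN2 ler_wpM2l // mulr_ge0 // subr_ge0 //.
exact: ltW.
Qed.

Lemma cqu_lambda_le_half : beta <= q -> forall n, lam n <= 2^-1.
Proof.
move=> bq n; apply: lam_le_half; rewrite radicandE lerBlDr lerDl.
by apply: mulr_ge0 => //; rewrite mulr_ge0 ?subr_ge0 // ltW.
Qed.

Lemma cqu_lambda_ni : q <= beta -> forall n, lam n.+1 <= lam n.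
Proof.
move=> qb n; apply: lam_le; rewrite !radicandE.
have := s_ni n; have : 0 <= (beta - q) * (1 - beta) by rewrite mulr_ge0 ?subr_ge0 // ltW.
by nra.
Qed.

Lemma cqu_lambda_sqr_ge : q <= beta -> forall n, 4^-1 <= lam n ^+ 2.
Proof.
move=> qb n; rewrite lam_sqr ler_peMr ?invr_ge0 // radicandE.
have := s_ge0 n; have : 0 <= (beta - q) * (1 - beta) by rewrite mulr_ge0 ?subr_ge0 // ltW.
by nra.
Qed.

Let le_half_of (n : nat) (c : R) :
  2 * c * (1 - beta * q ^+ n) <= 1 - q ^+ n -> c <= 2^-1.
Proof.
move=> h; have : 2 * c * (1 - beta * q ^+ n) <= 1 * (1 - beta * q ^+ n).
  by apply: (le_trans h); rewrite mul1r lerD2l lerN2 ler_piMl // ltW.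
by rewrite ler_pM2r //; lra.
Qed.

(* [(1 - q^n) / (2 (1 - beta q^n))] is a supersolution of the recursion
   [alpha_(n+1) = lambda_n^2 / (1 - alpha_n)]. *)
Lemma cqu_alpha_le n : 2 * al n * (1 - beta * q ^+ n) <= 1 - q ^+ n.
Proof.
elim: n => [|n IH]; first by rewrite /al /= mulr0 mul0r expr0 subrr.
have bn := bq_gt0 n; have bn1 := bq_gt0 n.+1.
have a1 : 0 < 1 - al n.
  by have := le_half_of _ _ IH; lra.
have -> : al n.+1 = lam n ^+ 2 / (1 - al n) by [].
rewrite lam_sqr.
have -> : 2 * (4^-1 * radicand n / (1 - al n)) * (1 - beta * q ^+ n.+1)
  = (1 - q ^+ n.+1) * ((1 - beta ^+ 2 * q ^+ n) / (2 * (1 - beta * q ^+ n) * (1 - al n))).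
  by rewrite /radicand; field; rewrite !gt_eqF.
rewrite ler_piMr ?(ltW (qS_gt0 n)) // ler_pdivrMr ?mulr_gt0 // mul1r.
(* By induction 2 (1 - beta q^n) (1 - alpha_n) >= 1 - 2 beta q^n + q^n, which exceeds 1 - beta^2 q^n
   by exactly q^n (1 - beta)^2. *)
have : 0 <= q ^+ n * (1 - beta) ^+ 2 by rewrite mulr_ge0 ?sqr_ge0.
by nra.
Qed.

Lemma cqu_alpha_le_half n : al n <= 2^-1.
Proof.
exact: le_half_of (cqu_alpha_le n).
Qed.

Let up_gt0 n : 0 < up n.
Proof. by rewrite /up /cqu_up divr_gt0 ?mulr_gt0. Qed.

Let one_sub_alpha_gt0 n : 0 < 1 - al n.
Proof. by have := cqu_alpha_le_half n; lra. Qed.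

(** * Pointwise recurrences and normalisation at 1 *)

Lemma horner_cqu_rec0 (x : R) : up 0%N * (cqu q beta 1%N).[x] = x.
Proof.
have := cqu_rec0 q_norm beta_norm; move: (cqu q beta 1%N) => c.
by move/(congr1 (horner^~ x)); rewrite /= mulr1 hornerX hornerZ.
Qed.

Lemma horner_cqu_recS (x : R) n : x * (cqu q beta n.+1).[x] =
  up n.+1 * (cqu q beta n.+2).[x] + down n.+1 * (cqu q beta n).[x].
Proof.
have := cqu_recS q_norm beta_norm n.
move: (cqu q beta n.+2) (cqu q beta n.+1) (cqu q beta n) => c d e.
by move/(congr1 (horner^~ x)); rewrite hornerD hornerM hornerX !hornerZ.
Qed.

Lemma horner_cquo_rec0 (x : R) : lam 0%N * (cquo q beta 1%N).[x] = x.
Proof.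
have := cquo_rec0 q_norm beta_norm; move: (cquo q beta 1%N) => c.
by move/(congr1 (horner^~ x)); rewrite /= mulr1 hornerX hornerZ.
Qed.

Lemma horner_cquo_recS (x : R) n : lam n.+1 * (cquo q beta n.+2).[x] =
  x * (cquo q beta n.+1).[x] - lam n * (cquo q beta n).[x].
Proof.
have := cquo_recS q_norm beta_norm n.
move: (cquo q beta n.+2) (cquo q beta n.+1) (cquo q beta n) => c d e.
move/(congr1 (horner^~ x)); rewrite hornerD hornerM hornerX !hornerZ => ->.
by rewrite addrK.
Qed.

(** Since lambda_n^2 = up_n down_(n+1), the recurrence at x = 1 is the recursion of alpha for 1 -
    up_n C_(n+1)(1) / C_n(1). Positivity is carried along because each step gets it from this
    identity. *)
Lemma cqu1_gt0 n : 0 < (cqu q beta n).[1] /\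
  up n * (cqu q beta n.+1).[1] = (1 - al n) * (cqu q beta n).[1].
Proof.
elim: n => [|n [IH1 IH2]].
  split; first by rewrite /= hornerC.
  by rewrite horner_cqu_rec0 /al /= subr0 hornerC mulr1.
have pos : 0 < (cqu q beta n.+1).[1].
  by rewrite -(pmulr_rgt0 _ (up_gt0 n)) IH2 mulr_gt0.
split=> //.
have e := horner_cqu_recS 1 n; rewrite mul1r in e.
have -> : al n.+1 = lam n ^+ 2 / (1 - al n) by [].
have c0 : (cqu q beta n).[1] = up n * (cqu q beta n.+1).[1] / (1 - al n).
  by rewrite IH2 mulrC mulKf // gt_eqF.
rewrite lam_up_down.
have -> : up n.+1 * (cqu q beta n.+2).[1]
  = (cqu q beta n.+1).[1] - down n.+1 * (cqu q beta n).[1] by rewrite {1}e addrK.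
by rewrite c0; ring.
Qed.

Lemma cqu_p0 (x : R) : cqu_p q beta 0 x = 1.
Proof. by rewrite /cqu_p /= !hornerC divr1. Qed.

Lemma cqu_p1 (x : R) : cqu_p q beta 1 x = x.
Proof.
have [c0 _] := cqu1_gt0 1; have u0 := up_gt0 0.
have e : up 0%N * (cqu q beta 1%N).[1] = 1 := horner_cqu_rec0 1.
transitivity (up 0%N * (cqu q beta 1%N).[x] / (up 0%N * (cqu q beta 1%N).[1])).
  by rewrite /cqu_p; move: (cqu q beta 1%N) c0 => C c0; field; rewrite !gt_eqF.
by rewrite e divr1 horner_cqu_rec0.
Qed.

Lemma cqu_p_rec (x : R) n : x * cqu_p q beta n.+1 x =
  (1 - al n.+1) * cqu_p q beta n.+2 x + al n.+1 * cqu_p q beta n x.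
Proof.
rewrite /cqu_p.
have [a_pos _] := cqu1_gt0 n; have [b_pos e1] := cqu1_gt0 n.+1.
have [c_pos _] := cqu1_gt0 n.+2.
have e2 := horner_cqu_recS 1 n; rewrite mul1r e1 in e2.
have ex := horner_cqu_recS x n.
move: a_pos b_pos c_pos e1 e2 ex (up_gt0 n.+1).
move: (cqu q beta n).[1] (cqu q beta n.+1).[1] (cqu q beta n.+2).[1] => A B C.
move: (cqu q beta n).[x] (cqu q beta n.+1).[x] (cqu q beta n.+2).[x] => a b c.
move: (al n.+1) (up n.+1) (down n.+1) => t u d A0 B0 C0 e1 e2 ex u0.
rewrite mulrA ex mulrDl; congr (_ + _).
  have -> : 1 - t = u * C / B by rewrite e1 mulfK // gt_eqF.
  by field; rewrite !gt_eqF.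
(* The recurrence at 1 gives B = (1 - t) B + d A. *)
have -> : t = d * A / B.
  by apply: (mulIf (lt0r_neq0 B0)); rewrite divfK ?gt_eqF //; lra.
by field; rewrite !gt_eqF.
Qed.

End QUltraspherical.

Theorem theorem4p1 (R : realType) (q beta : R) :
  (* (i) *)
  (0 <= beta -> beta <= q -> q < 1 ->
     [/\ nondecreasing_seq (cqu_lambda q beta),
         cqu_lambda q beta n @[n --> \oo] --> (2^-1 : R)
       & 0 < inf [set y : R | exists (x : R) (n : nat), (1 <= n)%N /\
                    y = (cquo q beta n.-1).[x] ^+ 2 + (cquo q beta n).[x] ^+ 2]])
  /\
  (* (ii) *)
  (0 <= q -> q <= beta -> beta < 1 ->
     [/\ nonincreasing_seq (cqu_lambda q beta) /\
           cqu_lambda q beta n @[n --> \oo] --> (2^-1 : R),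
         [/\ nondecreasing_seq (cqu_alpha q beta),
             nonincreasing_seq
               (fun n : nat => cqu_alpha q beta n.+1 - cqu_alpha q beta n)
           & cqu_alpha q beta n @[n --> \oo] --> (2^-1 : R)]
       & let c : R := 2 * cqu_alpha q beta 1 * (1 - cqu_alpha q beta 2)
                      / (1 - cqu_alpha q beta 1) in
         forall (n : nat) (x : R), (1 <= n)%N -> -1 < x -> x < 1 ->
           c * cqu_Delta q beta n 0 <= cqu_Delta q beta n x / (1 - x ^+ 2)]).
Proof.
split.
  move=> b0 bq q1.
  have q0 := le_trans b0 bq; have b1 := le_lt_trans bq q1.
  have nd : nondecreasing_seq (cqu_lambda q beta) by exact: cqu_lambda_nd.
  split=> //; first exact: cqu_lambda_cvg.
  have l0 : 0 < cqu_lambda q beta 0 by exact: cqu_lambda_gt0.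
  apply: (@lt_le_trans _ _ (2 * cqu_lambda q beta 0 ^+ 2)).
    by rewrite mulr_gt0 // exprn_gt0.
  (* A lower bound passes to [inf] only for a nonempty set; x = 0, n = 1 gives an element. *)
  apply: lb_le_inf.
    by exists ((cquo q beta 0).[0] ^+ 2 + (cquo q beta 1).[0] ^+ 2); exists 0, 1%N.
  move=> _ [x [[|n] [n_gt0 ->]]] //.
  apply: (@orthonormal_sqr_sum_ge R (cqu_lambda q beta)
            (fun k => (cquo q beta k).[x]) x) => //.
  - by move=> k; exact: nd.
  - exact: cqu_lambda_le_half.
  - by rewrite /= hornerC.
  - exact: horner_cquo_rec0.
  - by move=> k; exact: horner_cquo_recS.
move=> q0 qb b1.
have b0 := le_trans q0 qb; have q1 := le_lt_trans qb b1.
set al := cqu_alpha q beta; set lam := cqu_lambda q beta.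
have ah : forall n, al n <= 2^-1 by exact: cqu_alpha_le_half.
have ni n : lam n.+1 <= lam n by exact: cqu_lambda_ni.
have lam0 n : 0 < lam n by exact: cqu_lambda_gt0.
have L4 : forall n, 4^-1 <= lam n ^+ 2 by exact: cqu_lambda_sqr_ge.
have Lni n : lam n.+1 ^+ 2 <= lam n ^+ 2 by rewrite lerXn2r // nnegrE ltW.
have aS n : al n.+1 = lam n ^+ 2 / (1 - al n) by [].
have al_nd : forall n, al n <= al n.+1 by exact: (chain_le R al (fun n => lam n ^+ 2)).
have ac : forall n, al n.+2 - al n.+1 <= al n.+1 - al n.
  exact: (chain_concave R al (fun n => lam n ^+ 2)).
have lc : lam n @[n --> \oo] --> (2^-1 : R) by exact: cqu_lambda_cvg.
have a1 : 0 < al 1%N by rewrite aS divr_gt0 ?exprn_gt0 // subr0.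
split.
- by split=> //; apply/nonincreasing_seqP.
- split; [exact/nondecreasing_seqP | exact/nonincreasing_seqP |].
  apply: (chain_cvg R al (fun n => lam n ^+ 2)) => //.
  have -> : 4^-1 = 2^-1 * 2^-1 :> R by field.
  by under eq_fun do rewrite expr2; exact: cvgM.
- move=> c [|n] x // _ x_gt x_lt.
  have p_rec := cqu_p_rec R q beta q0 q1 b0 b1.
  (* The product separates the two sides; c >= 0 allows the bound at 0 to be multiplied by it. *)
  apply: (@le_trans _ _ (c * ratio_prod al n.+1)).
    rewrite ler_wpM2l //.
      by have := ah 1%N; have := ah 2%N => *; rewrite /c divr_ge0 ?mulr_ge0 ?(ltW a1) //; lra.
    apply: (turan0_le R al (cqu_p q beta ^~ 0) 0) => //.
    + exact: cqu_p0.
    + exact: cqu_p1.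
  apply: (turan_ge R al (cqu_p q beta ^~ x) x) => //.
  + exact: cqu_p0.
  + exact: cqu_p1.
Qed.
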